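(* Let $P$ be a graded bounded poset of rank $n$ with an EL-labeling $\lambda:\mathcal{E}(P)\to\Lambda$, and let $t\ge1$. For a word $\sigma=\sigma_1\cdots\sigma_n$ of length $n$ over $\Lambda$ let $e\ell_\lambda(\sigma)$ be the number of maximal chains $c$ of $P$ with $\lambda(c)=\sigma$. Then for every $J\subseteq[n-1]$: (1) $(-1)^{|J|-1}\mu(P_J)=\sum_{\sigma:\ \mathrm{Des}(\sigma)=J} e\ell_\lambda(\sigma)$, and hence $(-1)^{n-2}\mu(P)=\sum_{\sigma:\ \mathrm{Des}(\sigma)=[n-1]} e\ell_\lambda(\sigma)$; (2) $(-1)^{|J|-1}\mu(P^{(t)}_J)=\sum_{(\sigma^1,\ldots,\sigma^t):\ \mathrm{Des}(\sigma^1,\ldots,\sigma^t)=J}\ \prod_{i=1}^t e\ell_\lambda(\sigma^i)$, and hence $(-1)^{n-2}\mu(P^{(t)})=\sum \prod_{i=1}^t e\ell_\lambda(\sigma^i)$, the last sum over all $t$-tuples $(\sigma^1,\ldots,\sigma^t)$ of words of length $n$ over $\Lambda$ having no common ascent. Here all sums range over words of length $n$ over $\Lambda$ (respectively $t$-tuples of such words).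
   Context: An edge labeling $\lambda:\mathcal{E}(P)\to\Lambda$ assigns to each cover relation of $P$ an element of a poset $\Lambda$; a maximal chain $\hat0=x_0\lessdot x_1\lessdot\cdots\lessdot x_n=\hat1$ has label word $\lambda(c)=\lambda(x_0,x_1)\cdots\lambda(x_{n-1},x_n)$. For a word $\sigma=\sigma_1\cdots\sigma_n$, $\mathrm{Asc}(\sigma)=\{i\in[n-1]:\sigma_i<\sigma_{i+1}\text{ in }\Lambda\}$ and $\mathrm{Des}(\sigma)=[n-1]\setminus\mathrm{Asc}(\sigma)$; for a $t$-tuple of words, $\mathrm{Des}(\sigma^1,\ldots,\sigma^t)=[n-1]\setminus\bigcap_i\mathrm{Asc}(\sigma^i)$. $\lambda$ is an EL-labeling if in every interval $[x,y]$ there is a unique maximal chain whose label is strictly increasing, and its label word lexicographically precedes that of every other maximal chain of $[x,y]$. The $t$-fold Segre power $P^{(t)}$ ($t\ge2$) is the induced subposet of $P\times\cdots\times P$ ($t$ factors, componentwise order) of $t$-tuples of elements of equal rank; $P^{(1)}=P$. For a graded bounded poset $Q$ of rank $n$ and $J\subseteq[n-1]$, $Q_J$ is the subposet of elements with rank in $J$ together with $\hat0,\hat1$, and $\mu(Q)=\mu_Q(\hat0,\hat1)$ denotes the Möbius number. *)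

(* Defs.v *)
From HB Require Import structures.
From mathcomp Require Import all_boot all_order all_algebra.
From mathcomp Require Import boolp classical_sets functions cardinality fsbigop.

Set Implicit Arguments.
Unset Strict Implicit.
Unset Printing Implicit Defensive.

Import Order.TTheory GRing.Theory Num.Theory.

Local Open Scope ring_scope.
Local Open Scope order_scope.

Section Mobius.
Context {d : Order.disp_t} (Q : finPOrderType d).

(* The fuel [k] bounds the length of the intervals on which the recursion is
   exact; [#|Q|] is always enough, see [mobiusE]. *)
Fixpoint mobius_rec (k : nat) (x y : Q) : int :=
  if k is k'.+1 then
    if x == y then 1%R
    else (- \sum_(z : Q | (x <= z < y)%O) mobius_rec k' x z)%R
  else 0%R.

Definition mobius (x y : Q) : int := mobius_rec #|Q| x y.

Lemma mobius_rec_stable k l (x y : Q) :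
  (#|[set z : Q | (z <= y)%O]| <= k)%N -> (#|[set z : Q | (z <= y)%O]| <= l)%N ->
  mobius_rec k x y = mobius_rec l x y.
Proof.
have pos z : (0 < #|[set w : Q | (w <= z)%O]|)%N.
  by apply/card_gt0P; exists z; rewrite inE.
elim: k l y => [|k IH] [|l] y hk hl /=.
- by [].
- by have := leq_trans (pos y) hk.
- by have := leq_trans (pos y) hl.
case: eqP => // _; congr (- _)%R; apply: eq_bigr => z /andP[_ zy].
suff h : (#|[set w : Q | (w <= z)%O]| < #|[set w : Q | (w <= y)%O]|)%N.
  by apply: IH; rewrite -ltnS; [exact: leq_trans h hk | exact: leq_trans h hl].
apply: proper_card; apply/properP; split.
  by apply/fintype.subsetP => w; rewrite !inE => wz; exact: le_trans wz (ltW zy).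
by exists y; rewrite !inE ?lexx // lt_geF.
Qed.

Lemma mobiusE (x y : Q) :
  mobius x y = if x == y then 1%R
    else (- \sum_(z : Q | (x <= z < y)%O) mobius x z)%R.
Proof.
have le z : (#|[set w : Q | (w <= z)%O]| <= #|Q|)%N by exact: max_card.
by rewrite /mobius (@mobius_rec_stable #|Q| #|Q|.+1) ?le // ltnW // ltnS le.
Qed.

End Mobius.

Definition mobius_number {d : Order.disp_t} (Q : finTBPOrderType d) : int :=
  mobius (\bot : Q) (\top : Q).

Section Graded.
Context {d : Order.disp_t} (Q : finTBPOrderType d).

Definition covers (x y : Q) : bool :=
  (x < y) && ~~ [exists z : Q, (x < z) && (z < y)].

(* The maximal chain x = x_0 <. x_1 <. ... <. x_k = y of the interval [x, y]
   is represented by the sequence [:: x_1; ...; x_k], without its first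
   element x. *)
Definition maximal_chain (x y : Q) (s : seq Q) : bool :=
  path covers x s && (last x s == y).

Definition graded (n : nat) : Prop :=
  forall s : seq Q, maximal_chain \bot \top s -> size s = n.

(* The length of a longest chain \bot = x_0 < x_1 < ... < x_k = x. *)
Definition rank (x : Q) : nat :=
  (\max_(k < #|Q| | [exists s : k.-tuple Q,
                       path <%O \bot%O s && (last \bot%O s == x)]) k)%N.

End Graded.

Section RankSelection.
Context {d : Order.disp_t} (Q : finTBPOrderType d) (n : nat) (J : {set 'I_n}).

Definition rank_selected (x : Q) : bool :=
  [|| [exists j in J, rank x == j], x == \bot | x == \top].

Record rank_selection :=
  RankSelection { rsval :> Q; rsvalP : rank_selected rsval }.

HB.instance Definition _ := [isSub of rank_selection for rsval].
HB.instance Definition _ := [Finite of rank_selection by <:].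
HB.instance Definition _ :=
  [SubChoice_isSubPOrder of rank_selection by <: with d].

Fact rank_selected_bot : rank_selected \bot.
Proof. by rewrite /rank_selected eqxx orbT. Qed.

Fact rank_selected_top : rank_selected \top.
Proof. by rewrite /rank_selected eqxx !orbT. Qed.

Fact rs_le0x (x : rank_selection) : RankSelection rank_selected_bot <= x.
Proof. exact: le0x. Qed.

Fact rs_lex1 (x : rank_selection) : x <= RankSelection rank_selected_top.
Proof. exact: lex1. Qed.

HB.instance Definition _ := Order.hasBottom.Build d rank_selection rs_le0x.
HB.instance Definition _ := Order.hasTop.Build d rank_selection rs_lex1.

End RankSelection.

Section Segre.
Context {d : Order.disp_t} (P : finTBPOrderType d) (t : nat).

Definition equal_rank (x : t.-tupleprod P) : bool :=
  [forall i : 'I_t, forall j : 'I_t, rank (tnth x i) == rank (tnth x j)].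

Record segre_power := SegrePower { spval :> t.-tupleprod P;
                                   spvalP : equal_rank spval }.

HB.instance Definition _ := [isSub of segre_power for spval].
HB.instance Definition _ := [Finite of segre_power by <:].
HB.instance Definition _ :=
  [SubChoice_isSubPOrder of segre_power by <: with d].

Fact equal_rank_bot : equal_rank \bot.
Proof. by apply/'forall_forallP => i j; rewrite !tnth_mktuple. Qed.

Fact equal_rank_top : equal_rank \top.
Proof. by apply/'forall_forallP => i j; rewrite !tnth_mktuple. Qed.

Fact sp_le0x (x : segre_power) : SegrePower equal_rank_bot <= x.
Proof. exact: le0x. Qed.

Fact sp_lex1 (x : segre_power) : x <= SegrePower equal_rank_top.
Proof. exact: lex1. Qed.

HB.instance Definition _ := Order.hasBottom.Build d segre_power sp_le0x.
HB.instance Definition _ := Order.hasTop.Build d segre_power sp_lex1.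

End Segre.

Section Labeling.
Context {d d' : Order.disp_t} (P : finTBPOrderType d) (L : porderType d').
(* Only the values of [lam] on pairs (x, y) with [covers x y] are ever used. *)
Variable lam : P -> P -> L.

Definition label_word (x : P) (s : seq P) : seq L := pairmap lam x s.

Definition increasing_chain (x : P) (s : seq P) : bool :=
  sorted <%O (label_word x s).

Definition EL_labeling : Prop :=
  forall x y : P, x <= y ->
  exists s : seq P,
    [/\ maximal_chain x y s,
        increasing_chain x s,
        forall s', maximal_chain x y s' -> increasing_chain x s' -> s' = s
      & forall s', maximal_chain x y s' -> s' <> s ->
          (label_word x s : seqlexi L) < label_word x s'].

Definition el (n : nat) (sigma : n.-tuple L) : nat :=
  #|[set c : n.-tuple P | maximal_chain \bot \top c
                          && (label_word \bot c == sigma :> seq L)]%SET|.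

End Labeling.

(* {1, ..., n - 1}, as a subset of 'I_n = {0, ..., n - 1}. *)
Definition interior (n : nat) : {set 'I_n} := [set i : 'I_n | (0 < i)%N]%SET.

Section Words.
Context {d' : Order.disp_t} (L : porderType d') (n : nat).

(* Tuples are indexed from 0, so for 1 <= i <= n - 1 the letters sigma_i and
   sigma_(i+1) are the entries of index i - 1 and i. *)
Definition Asc (sigma : n.-tuple L) : {set 'I_n} :=
  [set i in interior n | tnth sigma (ord_pred i) < tnth sigma i]%SET.

Definition Des (sigma : n.-tuple L) : {set 'I_n} :=
  (interior n :\: Asc sigma)%SET.

Definition common_Asc (t : nat) (s : t.-tuple (n.-tuple L)) : {set 'I_n} :=
  (\bigcap_(i < t) Asc (tnth s i))%SET.

Definition tuple_Des (t : nat) (s : t.-tuple (n.-tuple L)) : {set 'I_n} :=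
  (interior n :\: common_Asc s)%SET.

End Words.

(* Main.v *)
Require Import Defs.
From HB Require Import structures.
From mathcomp Require Import all_boot all_order all_algebra.
From mathcomp Require Import boolp classical_sets functions cardinality fsbigop.

Set Implicit Arguments.
Unset Strict Implicit.
Unset Printing Implicit Defensive.

Import Order.TTheory GRing.Theory Num.Theory.

(** The argument applies to labels with an arbitrary relation [R] in place of
    an order; the Segre power is labeled by [t]-tuples of labels, compared by
    requiring a strict increase in every coordinate.

    Let [Q] be graded such that every interval has exactly one [R]-increasing
    maximal chain. For [x] of rank [m > 0] let [g x] be the number of maximal
    chains of [[0, x]] with descent set [J] (cut off at [m]). By induction,
    [mu(0, x) = - (-1)^|J_{<m}| g x] in the rank selection. Indeed, continuing
    a chain counted by [g z], [rk z = j], by the increasing chain of [[z, x]]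
    shows that the sum of [g z] over the [z < x] of rank [j] counts the chains
    to [x] whose descent set agrees with [J] below [j] and is empty above [j].
    If [a_j] is the number of chains to [x] with descent set [J_{<j}], this
    sum is [a_j + a_{j+1}] for [j] in [J], and the recursion for [mu]
    telescopes from [a_1 = 1] to [a_m = g x]. *)

(** * Chains along a rank function *)

Section GradedChains.
Local Open Scope order_scope.
Context {d : Order.disp_t} {Q : finTBPOrderType d} (rk : Q -> nat).

(** For the rank function of an EL-labeled graded poset this is the cover relation ([coversE]); its
    numerical form is easy to check coordinatewise in a Segre power. *)
Definition rcovers (x y : Q) : bool := (x < y) && (rk y == (rk x).+1).

Definition rchain (x y : Q) (s : seq Q) : bool :=
  path rcovers x s && (last x s == y).

Lemma rchain_size x y s : rchain x y s -> rk y = (rk x + size s)%N.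
Proof.
case/andP=> + /eqP <-; elim: s x => [|z s IH] x /=; first by rewrite addn0.
by case/andP=> /andP[_ /eqP e] /IH ->; rewrite e addnS.
Qed.

Lemma rchain_cat x z y s u :
  rchain x z s -> rchain z y u -> rchain x y (s ++ u).
Proof.
case/andP=> ps /eqP lz /andP[pu ly].
by rewrite /rchain cat_path last_cat lz ps pu ly.
Qed.

Lemma rchain_take x y s j :
  rchain x y s -> rchain x (last x (take j s)) (take j s).
Proof.
case/andP=> ps _; rewrite /rchain eqxx andbT.
by move: ps; rewrite -{1}(cat_take_drop j s) cat_path => /andP[].
Qed.

Lemma rchain_drop x y s j :
  rchain x y s -> rchain (last x (take j s)) y (drop j s).
Proof.
rewrite /rchain -{1 2}(cat_take_drop j s) cat_path last_cat.
by case/andP=> /andP[_ ->] ->.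
Qed.

Lemma rchain_le x y s : rchain x y s -> x <= y.
Proof.
case/andP=> + /eqP <-; elim: s x => [|z s IH] x //=.
by case/andP=> /andP[/ltW xz _] /IH; exact: le_trans.
Qed.

(** Strict monotonicity bounds every chain from [\bot] to [x] by [rk x], and the assumed chain
    attains the bound. *)
Lemma rank_unique :
    {homo rk : x y / x < y >-> (x < y)%N} ->
    (forall x, exists s,
       path <%O \bot s && (last \bot s == x) && (size s == rk x)) ->
  forall x, rank x = rk x.
Proof.
move=> rk_mono ex x; apply/eqP; rewrite eqn_leq; apply/andP; split.
  apply/bigmax_leqP => k /existsP[s /andP[ps /eqP <-]].
  rewrite -[leqLHS](size_tuple s); move: (tval s) ps => {k s}.
  elim/last_ind => [|u z IH] //=.
  rewrite rcons_path last_rcons size_rcons => /andP[/IH h /rk_mono].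
  exact: leq_ltn_trans.
have [s /andP[/andP[ps ls] /eqP sz]] := ex x.
(* The maximum in [rank] runs over lengths below [#|Q|]; a strict chain together with [\bot] has no
   repetitions, so [rk x] is among them. *)
have lt : (rk x < #|Q|)%N.
  rewrite -sz; have := max_card (mem (\bot :: s)).
  rewrite (card_uniqP _) //; apply: (@sorted_uniq _ <%O) => //.
  exact: lt_trans.
have := @leq_bigmax_cond _ (fun k : 'I_#|Q| => [exists s : k.-tuple Q,
  path <%O \bot s && (last \bot s == x)]) (fun k => k : nat) (Ordinal lt).
apply; apply/existsP => /=; rewrite -sz.
by exists (in_tuple s); rewrite ps.
Qed.

End GradedChains.

(** * Counting chains by descent set *)

Section DescentCount.
Local Open Scope order_scope.
Context {d : Order.disp_t} {Q : finTBPOrderType d} (rk : Q -> nat).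
Context {L : Type} (lam : Q -> Q -> L) (R : rel L).

(* As in [Asc], positions start at 1: the chain is [x = c_0 <. c_1 <. ...] and
   position [i] compares the labels of the edges below and above [c_i]. *)
Definition ascent (x : Q) (s : seq Q) (i : nat) : bool :=
  let c := nth \bot (x :: s) in R (lam (c i.-1) (c i)) (lam (c i) (c i.+1)).

Definition rincreasing (x : Q) (s : seq Q) : bool :=
  sorted R (pairmap lam x s).

Lemma rincreasingP x s :
  reflect (forall i, (0 < i < size s)%N -> ascent x s i) (rincreasing x s).
Proof.
apply: (iffP (sortedP (lam x x))); rewrite size_pairmap => h.
  case=> // i /= lt; have := h _ lt.
  by rewrite !(nth_pairmap \bot) // ltnW.
move=> i lt; rewrite !(nth_pairmap \bot) //; last exact: ltnW.
exact: (h i.+1).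
Qed.

Lemma ascent_catl x s u i :
  (i < size s)%N -> ascent x (s ++ u) i = ascent x s i.
Proof.
move=> lt; rewrite /ascent -cat_cons !nth_cat /= !ltnS lt (ltnW lt).
by rewrite (leq_trans (leq_pred i) (ltnW lt)).
Qed.

Lemma ascent_catr x s u i :
  (0 < i)%N -> ascent x (s ++ u) (size s + i) = ascent (last x s) u i.
Proof.
case: i => // i _; rewrite /ascent !addnS /=.
have h k : nth \bot (x :: (s ++ u)) (size s + k) = nth \bot (last x s :: u) k.
  case: k => [|k]; last by rewrite addnS /= nth_cat ltnNge leq_addr /= addKn.
  by rewrite addn0 (last_nth \bot) -cat_cons nth_cat /= ltnS leqnn.
by have := h i; have := h i.+1; have := h i.+2; rewrite !addnS /= => -> -> ->.
Qed.

Hypothesis rk_mono : {homo rk : x y / x < y >-> (x < y)%N}.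
Hypothesis rk_bot : rk \bot = 0%N.
Hypothesis inc_unique : forall x y, x <= y ->
  exists2 s, rchain rk x y s && rincreasing x s &
    forall s', rchain rk x y s' -> rincreasing x s' -> s' = s.

Variable J : pred nat.

Definition descent_chains m x : {set m.-tuple Q} :=
  [set s : m.-tuple Q | rchain rk \bot x s &
    [forall i : 'I_m, (0 < i)%N ==> (ascent \bot s i != J i)]].

(** The chains counted by [a_j] in the telescoping sum. *)
Definition trunc_chains j m x : {set m.-tuple Q} :=
  [set s : m.-tuple Q | rchain rk \bot x s &
    [forall i : 'I_m, (0 < i)%N ==> (ascent \bot s i != (i < j)%N && J i)]].

(** Position [j] is left free: gluing an increasing chain on top at rank [j] gives no control over
    the comparison there. *)
Definition split_chains j m x : {set m.-tuple Q} :=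
  [set s : m.-tuple Q | rchain rk \bot x s &
    [forall i : 'I_m, (0 < i)%N ==> (i != j :> nat) ==>
       (ascent \bot s i != (i < j)%N && J i)]].

Lemma trunc_chains_full m x : trunc_chains m m x = descent_chains m x.
Proof.
apply/setP => s; rewrite !inE; congr (_ && _).
by apply: eq_forallb => i; rewrite ltn_ord.
Qed.

Lemma trunc_chainsS j m x :
  ~~ J j -> trunc_chains j.+1 m x = trunc_chains j m x.
Proof.
move=> nJ; apply/setP => s; rewrite !inE; congr (_ && _).
apply: eq_forallb => i; congr (_ ==> (_ != _)); rewrite ltnS leq_eqVlt.
by have [->|] := eqVneq (i : nat) j; rewrite ?(negbTE nJ) ?andbF.
Qed.

(** Classify by the free position: an ascent at [j] means [J] cut off at [j], a descent means [J]
    cut off at [j.+1], because [j] lies in [J]. *)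
Lemma card_split_chains j m x : (0 < j < m)%N -> J j ->
  #|split_chains j m x| = (#|trunc_chains j m x| + #|trunc_chains j.+1 m x|)%N.
Proof.
case/andP=> j0 jm Jj; rewrite -(cardsID [set s | ascent \bot (tval s) j]).
(* Here [b] says whether [j] must be a descent; away from [j] the cut-offs at [k] and at [j] impose
   the same conditions. *)
have sp (s : m.-tuple Q) k b : (forall i : nat, (i < k)%N && J i =
     if i == j then b else (i < j)%N && J i) ->
  (s \in trunc_chains k m x) =
  (s \in split_chains j m x) && (ascent \bot s j != b).
  move=> hk; rewrite !inE; case: rchain => //=.
  apply/forallP/andP => [h|[/forallP h asc] i].
    split; last by have := h (Ordinal jm); rewrite /= j0 hk eqxx.
    apply/forallP => i; have := h i; rewrite hk.
    by case: (i =P j :> nat) => _ /=; case: (0 < i)%N => //=.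
  have := h i; rewrite hk; case: (i =P j :> nat) => [->|//].
  by rewrite asc implybT.
congr (_ + _)%N; apply: eq_card => s.
  rewrite (sp s j false) => [|i]; last by case: eqP => [->|//]; rewrite ltnn.
  by rewrite inE; congr (_ && _); rewrite inE; case: ascent.
rewrite (sp s j.+1 true) => [|i].
  by rewrite inE andbC; congr (_ && _); rewrite inE; case: ascent.
by rewrite ltnS leq_eqVlt; case: eqP => [->|//]; rewrite Jj.
Qed.

(* Glueing the increasing chain of [z, x] to a chain from the bottom to [z]. *)
Lemma sum_descent_chains j m x : rk x = m -> (j < m)%N ->
  (\sum_(z : Q | (z < x)%O && (rk z == j)) #|descent_chains j z|)%N =
  #|split_chains j m x|.
Proof.
move=> rkx jm.
have -> : (\sum_(z : Q | (z < x)%O && (rk z == j)) #|descent_chains j z|)%N =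
  #|[set s : j.-tuple Q |
      (last \bot s < x) && (s \in descent_chains j (last \bot s))]|.
  rewrite -sum1_card (partition_big (fun s : j.-tuple Q => last \bot s)
    (fun z => (z < x) && (rk z == j))) /= => [|s].
    apply: eq_bigr => z /andP[zx _]; rewrite -sum1_card; apply: eq_bigl => s.
    rewrite !inE; have [e|ne] := eqVneq (last \bot s) z.
      by rewrite e zx andbT.
    by rewrite andbF /rchain (negbTE ne) andbF.
  rewrite !inE => /and3P[-> /rchain_size + _] /=.
  by rewrite rk_bot size_tuple => ->.
(* Truncation at rank [j], to be shown a bijection from the split chains onto the set just
   formed. *)
pose phi (s : m.-tuple Q) : j.-tuple Q := [tuple nth \bot s i | i < j].
have phiE s : phi s = take j s :> seq Q.
  apply: (@eq_from_nth _ \bot).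
    by rewrite size_tuple size_takel // size_tuple ltnW.
  move=> i; rewrite size_tuple => lt.
  by rewrite nth_take // -[i]/(val (Ordinal lt)) -tnth_nth tnth_mktuple.
have szt (s : m.-tuple Q) : size (take j s) = j.
  by rewrite size_takel // size_tuple ltnW.
have inc (s : m.-tuple Q) : s \in split_chains j m x ->
    rincreasing (last \bot (take j s)) (drop j s).
  rewrite inE => /andP[_ /forallP h]; apply/rincreasingP => i.
  rewrite size_drop size_tuple => /andP[i0 lt].
  rewrite -ascent_catr // cat_take_drop szt.
  have lt' : (j + i < m)%N by rewrite -ltn_subRL.
  have := h (Ordinal lt'); rewrite /= addn_gt0 i0 orbT /=.
  rewrite [(j + i < j)%N]ltnNge leq_addr /=.
  by rewrite -{2}(addn0 j) eqn_add2l -lt0n i0 /=; case: ascent.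
rewrite -(@card_in_imset _ _ phi) => [|s s' hs hs' e].
  apply: eq_card => s; apply/idP/imsetP => [|[s' hs' ->]].
    rewrite inE => /andP[lx]; rewrite inE => /andP[cs /forallP hs].
    (* Surjectivity: extend by the increasing chain up to [x]. *)
    have [u /andP[cu iu] _] := inc_unique (ltW lx).
    have cc := rchain_cat cs cu.
    have sz : size (s ++ u) == m.
      by have := rchain_size cc; rewrite rk_bot rkx add0n => ->.
    exists (Tuple sz); last first.
      by apply/val_inj; rewrite [RHS]phiE /= take_size_cat // size_tuple.
    rewrite inE /= cc; apply/forallP => i.
    apply/implyP => i0; apply/implyP => ij.
    case: ltngtP ij => // [lt|gt] _.
      rewrite /= ascent_catl ?size_tuple //.
      by have := hs (Ordinal lt); rewrite i0.
    rewrite -(subnKC (ltnW gt)) -[X in (X + _)%N](size_tuple s).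
    rewrite ascent_catr ?subn_gt0 //.
    rewrite (rincreasingP _ _ iu) // subn_gt0 gt /=.
    have szu : size u = (m - j)%N.
      by move/eqP: sz; rewrite size_cat size_tuple => <-; rewrite addKn.
    by rewrite szu ltn_sub2r // ltn_ord.
  have := hs'; rewrite [_ \in split_chains _ _ _]inE => /andP[cs /forallP h].
  rewrite inE phiE; apply/andP; split.
    rewrite lt_neqAle (rchain_le (rchain_drop j cs)) andbT.
    apply/eqP => e; have := rchain_size (rchain_take j cs).
    by rewrite rk_bot szt e rkx add0n => e'; rewrite e' ltnn in jm.
  rewrite inE phiE (rchain_take j cs); apply/forallP => i; apply/implyP => i0.
  have lt : (i < m)%N by apply: ltn_trans jm.
  have := h (Ordinal lt); rewrite /= i0 ltn_ord (ltn_eqF (ltn_ord i)) /=.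
  by rewrite -{1}(cat_take_drop j s') ascent_catl // szt.
(* Injectivity: the parts above rank [j] are increasing chains between the same two elements, hence
   equal. *)
apply/val_inj => /=; rewrite -(cat_take_drop j s) -(cat_take_drop j s').
have e' : take j s = take j s' by rewrite -!phiE e.
rewrite -e'; congr (_ ++ _).
have cs : rchain rk \bot x s by move: hs; rewrite inE => /andP[].
have cs' : rchain rk \bot x s' by move: hs'; rewrite inE => /andP[].
have dl := rchain_drop j cs.
have [u _ uu] := inc_unique (rchain_le dl).
rewrite (uu _ dl (inc _ hs)); apply/esym/uu; first by rewrite e' rchain_drop.
by rewrite e' inc.
Qed.

(** A cut-off at 1 allows no descent at any position, so only the increasing chain remains. *)
Lemma card_trunc_chains1 m x : rk x = m -> #|trunc_chains 1 m x| = 1%N.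
Proof.
move=> rkx; have [u /andP[cu /rincreasingP iu] uu] := inc_unique (le0x x).
have sz : size u == m by have := rchain_size cu; rewrite rk_bot rkx => ->.
rewrite -[RHS](cards1 (Tuple sz)); congr #|pred_of_set _|; apply/setP => s.
have hi (b : seq Q) (i : nat) : (0 < i)%N ->
    (ascent \bot b i != ((i < 1)%N && J i)) = ascent \bot b i.
  by case: i => //= i _; case: ascent.
rewrite !inE; apply/andP/eqP => [[cs /forallP h]|->].
  apply/val_inj/uu => //; apply/rincreasingP => i.
  rewrite size_tuple => /andP[i0 lt].
  by have := h (Ordinal lt); rewrite hi // => /implyP; apply.
split=> //; apply/forallP => i; apply/implyP => i0; rewrite hi //.
by apply: iu; rewrite i0 (eqP sz) ltn_ord.
Qed.

Local Open Scope ring_scope.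

Definition level_sign m : int := (-1) ^+ (\sum_(1 <= i < m) J i)%N.

Lemma split_chains_telescope m x : rk x = m -> (0 < m)%N ->
  1 - \sum_(1 <= j < m | J j) level_sign j * #|split_chains j m x|%:Z =
  level_sign m * #|descent_chains m x|%:Z.
Proof.
move=> rkx m0; rewrite -trunc_chains_full.
(* Partial sums with [m] fixed: the sum through [k] leaves only the term with [a_{k+1}]. A rank in
   [J] flips the sign; a rank outside [J] changes neither sign nor count. *)
suff H k : (k < m)%N ->
    1 - \sum_(1 <= j < k.+1 | J j) level_sign j * #|split_chains j m x|%:Z =
    level_sign k.+1 * #|trunc_chains k.+1 m x|%:Z.
  by have := H m.-1; rewrite prednK // leqnn; apply.
elim: k => [|k IH] lt.
  rewrite big_geq // /level_sign big_geq //.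
  by rewrite card_trunc_chains1 // subr0 mulr1.
rewrite big_mkcond big_nat_recr //= -big_mkcond opprD addrA IH 1?ltnW //.
rewrite {3}/level_sign big_nat_recr //= exprD -/(level_sign _).
case: ifP => Jk; last by rewrite subr0 expr0 mulr1 (@trunc_chainsS k.+1) ?Jk.
rewrite card_split_chains // PoszD mulrDr opprD addrA addrN sub0r.
by rewrite expr1 mulrN1 mulNr.
Qed.

(** * The Möbius function along an order embedding *)

Section Mobius.
Local Open Scope order_scope.
Context {dS : Order.disp_t} {S : finTBPOrderType dS} (f : S -> Q).
Hypothesis f_le : {mono f : x y / x <= y >-> x <= y}.
Hypothesis f_bot : f \bot = \bot.
Hypothesis f_img : forall q, (exists x, f x = q) <->
  [|| J (rk q), q == \bot | q == \top].
Hypothesis J0 : ~~ J 0%N.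

(** The poset enters through an order embedding [f] onto the selected elements, so that rank
    selections and the whole poset are treated at once. *)
Lemma mobius_descents (x : S) : x != \bot ->
  mobius \bot x = - (level_sign (rk (f x)) *
                     #|descent_chains (rk (f x)) (f x)|%:Z).
Proof.
have f_inj : injective f by exact: inc_inj.
have f_lt : {mono f : x y / x < y >-> x < y} by exact: leW_mono.
have [k le] := ubnP (rk (f x)); elim: k => // k IH in x le * => xb.
rewrite mobiusE eq_sym (negbTE xb); congr (- _).
have m0 : (0 < rk (f x))%N.
  by rewrite -rk_bot -f_bot rk_mono // f_lt lt0x.
(* The term of [\bot] is the leading 1 of the telescoped sum. *)
rewrite -split_chains_telescope // (bigD1 \bot) /=; last by rewrite lexx lt0x.
rewrite {1}mobiusE eqxx; congr (1 + _); rewrite -sumrN.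
under eq_bigr => z /andP[/andP[_ zx] zb].
  rewrite IH //; last by rewrite -ltnS (leq_trans _ le) // ltnS rk_mono ?f_lt.
  over.
pose F q := - (level_sign (rk q) * #|descent_chains (rk q) q|%:Z).
(* Along [f] the elements strictly between [\bot] and [x] become all [q < f x] with rank in [J]:
   [\top] is not below [f x], and [\bot] has rank 0, outside [J]. *)
transitivity (\sum_(q : Q | (q < f x) && J (rk q)) F q).
  rewrite [RHS](eq_bigl (fun q =>
    q \in f @: [set z | (z < x) && (z != \bot)])) => [|q].
    rewrite big_imset => [/=|z z' _ _]; last exact: f_inj.
    by apply: eq_big => [z|z _]; rewrite ?inE ?le0x // -sumrN.
  apply/esym; apply/imsetP/andP => [[z + ->]|[lt Jq]].
    rewrite inE => /andP[zx zb]; rewrite f_lt zx; split=> //.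
    have /f_img/or3P[//|/eqP|/eqP] : exists y, f y = f z by exists z.
      by rewrite -f_bot => /f_inj e; rewrite e eqxx in zb.
    by move=> e; have := lex1 (f x); rewrite -e f_le lt_geF.
  have /f_img[z e] : [|| J (rk q), q == \bot | q == \top] by rewrite Jq.
  exists z => //; rewrite inE -f_lt e lt; apply/eqP => zb.
  by move: Jq; rewrite -e zb f_bot rk_bot (negbTE J0).
have [m mE] : exists m, rk (f x) = m.+1 by exists (rk (f x)).-1; rewrite prednK.
(* Group the [q] by rank; [inord] is faithful because elements below [f x] have rank less than
   [m.+1]. *)
rewrite (partition_big (fun q => inord (rk q) : 'I_m.+1) (fun j => J j)) /=;
  last first.
  by move=> q /andP[/rk_mono lt Jq]; rewrite inordK // -mE.
rewrite mE [RHS](_ : _ = \sum_(0 <= j < m.+1 | J j)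
  - (level_sign j * #|split_chains j m.+1 (f x)|%:Z)).
  rewrite big_mkord; apply: eq_bigr => j Jj.
  rewrite -(sum_descent_chains mE) // -[Posz _]natz natr_sum mulr_sumr -sumrN.
  have h q : q < f x -> (inord (rk q) == j) = (rk q == j).
    by move=> /rk_mono lt; rewrite -val_eqE /= inordK // -mE.
  apply: eq_big => [q|q /andP[/andP[lt _] /eqP jE]].
    have [lt|//] := boolP (q < f x); rewrite h //=.
    by case: eqP => [->|]; rewrite ?andbF ?Jj.
  by have := h _ lt; rewrite jE eqxx => /esym/eqP e; rewrite /F e natz.
by rewrite [RHS]big_ltn_cond // (negbTE J0).
Qed.
End Mobius.
End DescentCount.

(** * Möbius numbers of rank selections as chain counts *)

Section RankSelectedMobius.
Local Open Scope ring_scope.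
Local Open Scope order_scope.
Context {d : Order.disp_t} {Q : finTBPOrderType d} (rk : Q -> nat).
Context {L : Type} (lam : Q -> Q -> L) (R : rel L) (n : nat).
Hypothesis rk_mono : {homo rk : x y / x < y >-> (x < y)%N}.
Hypothesis rk_bot : rk \bot = 0%N.
Hypothesis rk_top : rk \top = n.
Hypothesis rankE : forall x : Q, rank x = rk x.
Hypothesis inc_unique : forall x y, x <= y ->
  exists2 s, rchain rk x y s && rincreasing lam R x s &
    forall s', rchain rk x y s' -> rincreasing lam R x s' -> s' = s.
Hypothesis n_gt0 : (0 < n)%N.

Definition Des_chains (J : {set 'I_n}) : {set n.-tuple Q} :=
  [set s : n.-tuple Q | rchain rk \bot \top s &
    [forall i : 'I_n, (0 < i)%N ==> (ascent lam R \bot s i != (i \in J))]].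

(** The exponent is an integer because |J| - 1 is -1 for empty [J]; that case holds since -1 is its
    own inverse. *)
Lemma signK k (X : int) : (-1) ^ (k%:Z - 1) * - ((-1) ^+ k * X) = X.
Proof.
case: k => [|k].
  by rewrite expr0 mul1r add0r (_ : (-1) ^ (-1) = -1 :> int) // mulN1r opprK.
rewrite -addn1 PoszD addrK addn1 exprS mulN1r mulNr opprK -exprnP mulrA.
by rewrite -exprMn mulrNN mulr1 expr1n mul1r.
Qed.

Lemma exists_ord_in (J : {set 'I_n}) (i : 'I_n) :
  [exists j in J, i == j :> nat] = (i \in J).
Proof.
apply/existsP/idP => [[j /andP[jJ /eqP/val_inj->]] //|iJ].
by exists i; rewrite iJ eqxx.
Qed.

Section Embedding.
Context {dS : Order.disp_t} {S : finTBPOrderType dS} (f : S -> Q).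
Variable J : {set 'I_n}.
Hypothesis J_interior : J \subset interior n.
Hypothesis f_le : {mono f : x y / x <= y >-> x <= y}.
Hypothesis f_bot : f \bot = \bot.
Hypothesis f_top : f \top = \top.
Hypothesis f_img : forall q, (exists x, f x = q) <-> rank_selected J q.

(** This is [mobius_descents] at the top: all of [J] lies below rank [n], so nothing is cut off and
    [level_sign] has exponent |J|. *)
Lemma mobius_number_embedding :
  (-1) ^ (#|J|%:Z - 1) * mobius_number S = #|Des_chains J|%:Z.
Proof.
pose Jn k := [exists j in J, k == j :> nat].
have J0 : ~~ Jn 0%N.
  apply/existsP => -[j /andP[jJ /eqP j0]].
  by have := fintype.subsetP J_interior _ jJ; rewrite inE -j0.
(* Here [n > 0] separates the two ends. *)
have top_neq0 : (\top : S) != \bot.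
  by apply/eqP => e; move: n_gt0; rewrite -rk_top -f_top e f_bot rk_bot.
have f_img' q : (exists x, f x = q) <-> [|| Jn (rk q), q == \bot | q == \top].
  by rewrite f_img /rank_selected rankE.
have mu := mobius_descents rk_mono rk_bot inc_unique f_le f_bot f_img' J0.
rewrite /mobius_number mu //.
rewrite f_top rk_top /level_sign.
have -> : (\sum_(1 <= i < n) Jn i)%N = #|J|.
  transitivity (\sum_(0 <= i < n) Jn i)%N.
    by rewrite [RHS]big_ltn // (negbTE J0).
  rewrite big_mkord -sum1_card [RHS]big_mkcond; apply: eq_bigr => i _.
  by rewrite /Jn exists_ord_in; case: (i \in J).
rewrite signK; congr (Posz _); apply: eq_card => s; rewrite !inE.
by congr (_ && _); apply: eq_forallb => i; rewrite /Jn exists_ord_in.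
Qed.

End Embedding.

Lemma mobius_rank_selection (J : {set 'I_n}) : J \subset interior n ->
  (-1) ^ (#|J|%:Z - 1) * mobius_number (rank_selection Q J) =
  #|Des_chains J|%:Z.
Proof.
move=> Jint; apply: (@mobius_number_embedding _ _ (@rsval _ Q n J)) => // q.
split=> [[x <-]|h]; first exact: rsvalP.
by exists (RankSelection h).
Qed.

Lemma card_interior : #|interior n| = n.-1.
Proof.
have := cardsC1 (Ordinal n_gt0); rewrite card_ord => <-.
by apply: eq_card => i; rewrite !inE -val_eqE /= lt0n.
Qed.

(** Take the identity as embedding: an element other than the two ends has rank strictly between 0
    and [n], so [interior n] selects everything. *)
Lemma mobius_graded :
  (-1) ^ (n%:Z - 2) * mobius_number Q = #|Des_chains (interior n)|%:Z.
Proof.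
rewrite -(@mobius_number_embedding _ Q id) // => [|q].
  congr (_ ^ _ * _); rewrite card_interior -{1}(prednK n_gt0) -addn1 PoszD.
  by rewrite -addrA.
split=> // _; last by exists q.
rewrite /rank_selected rankE.
have [->|qb] := eqVneq q \bot; first by rewrite orbT.
have [->|qt] := eqVneq q \top; first by rewrite !orbT.
have lt : (rk q < n)%N by rewrite -rk_top rk_mono // ltx1.
have gt : (0 < rk q)%N by rewrite -rk_bot rk_mono // lt0x.
by rewrite /= orbF; apply/existsP; exists (Ordinal lt); rewrite inE gt /=.
Qed.

End RankSelectedMobius.

(** * Rank and covers in an EL-labeled graded poset *)

Section GradedEL.
Local Open Scope order_scope.
Context {d d' : Order.disp_t} {P : finTBPOrderType d} {L : porderType d'}.
Context {lam : P -> P -> L} {n : nat}.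
Hypothesis gradedP : graded P n.
Hypothesis EL : EL_labeling lam.

Lemma maximal_chain_cat (x y z : P) s u :
  maximal_chain x y s -> maximal_chain y z u -> maximal_chain x z (s ++ u).
Proof.
case/andP=> ps /eqP e /andP[pu lu].
by rewrite /maximal_chain cat_path last_cat e ps pu lu.
Qed.

Lemma EL_maximal_chain (x y : P) : x <= y -> exists s, maximal_chain x y s.
Proof. by move=> /EL[s [cs _ _ _]]; exists s. Qed.

(** A maximal chain up to [x], continued by a fixed one to the top, has total length [n], so all
    such chains have one length; this length is strictly monotone and [rank_unique] applies. *)
Lemma rank_maximal_chain (x : P) s : maximal_chain \bot x s -> rank x = size s.
Proof.
pose sz y := size (xchoose (EL_maximal_chain (lex1 y))).
have szE y u : maximal_chain \bot y u -> (size u + sz y)%N = n.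
  move=> cu; rewrite -size_cat; apply: gradedP; apply: maximal_chain_cat cu _.
  exact: xchooseP.
pose rk y := (n - sz y)%N.
have rkE y u : maximal_chain \bot y u -> rk y = size u.
  by move=> /szE; rewrite /rk => <-; rewrite addnK.
suff h y : rank y = rk y by move=> /rkE <-.
apply: rank_unique => {s x y} [x y xy|x].
  have [s cs] := EL_maximal_chain (le0x x).
  have [u cu] := EL_maximal_chain (ltW xy).
  rewrite (rkE _ _ cs) (rkE _ _ (maximal_chain_cat cs cu)) size_cat.
  case: u cu => [|z u] cu; last by rewrite addnS ltnS leq_addr.
  by case/andP: cu => _ /eqP e; rewrite -e ltxx in xy.
have [s cs] := EL_maximal_chain (le0x x); exists s.
rewrite (rkE _ _ cs) eqxx andbT; case/andP: cs => ps ->; rewrite andbT.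
by apply: sub_path ps => y z /andP[].
Qed.

Lemma EL_rank_bot : rank (\bot : P) = 0%N.
Proof. by rewrite (@rank_maximal_chain _ [::]) // /maximal_chain /= eqxx. Qed.

Lemma EL_rank_top : rank (\top : P) = n.
Proof.
have [s cs] := EL_maximal_chain (le0x \top).
by rewrite (rank_maximal_chain cs) (gradedP cs).
Qed.

Lemma EL_rank_mono : {homo (@rank d P) : x y / x < y >-> (x < y)%N}.
Proof.
move=> x y xy; have [s cs] := EL_maximal_chain (le0x x).
have [u cu] := EL_maximal_chain (ltW xy).
rewrite (rank_maximal_chain cs).
rewrite (rank_maximal_chain (maximal_chain_cat cs cu)) size_cat.
case: u cu => [|z u] cu; last by rewrite addnS ltnS leq_addr.
by case/andP: cu => _ /eqP e; rewrite -e ltxx in xy.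
Qed.

(** A cover lengthens a maximal chain by one; conversely, nothing fits between consecutive ranks. *)
Lemma coversE (x y : P) : covers x y = rcovers (@rank d P) x y.
Proof.
apply/idP/andP => [c|[xy /eqP e]].
  split; first by case/andP: c.
  have [s cs] := EL_maximal_chain (le0x x).
  have cy : maximal_chain x y [:: y] by rewrite /maximal_chain /= c eqxx.
  rewrite (rank_maximal_chain cs).
  by rewrite (rank_maximal_chain (maximal_chain_cat cs cy)) size_cat addn1.
rewrite /covers xy; apply/existsP.
case=> z /andP[/EL_rank_mono xz /EL_rank_mono zy].
by move: zy; rewrite e ltnS leqNgt xz.
Qed.

Lemma maximal_chainE (x y : P) s :
  maximal_chain x y s = rchain (@rank d P) x y s.
Proof. by rewrite /maximal_chain (eq_path coversE). Qed.

Lemma EL_inc_unique (x y : P) : x <= y ->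
  exists2 s, rchain (@rank d P) x y s && rincreasing lam <%O x s &
    forall s', rchain (@rank d P) x y s' -> rincreasing lam <%O x s' -> s' = s.
Proof.
case/EL=> s [cs incs us _]; exists s; first by rewrite -maximal_chainE cs.
by move=> s'; rewrite -maximal_chainE; exact: us.
Qed.

End GradedEL.

(** * Chains of the Segre power *)

Section SegreChains.
Local Open Scope order_scope.
Context {d d' : Order.disp_t} {P : finTBPOrderType d} {L : porderType d'}.
Context (lam : P -> P -> L) {t : nat} (t_gt0 : (0 < t)%N).
Local Notation Q := (segre_power P t).
Local Notation rkP := (@rank d P).
Hypothesis rank_mono : {homo rkP : x y / x < y >-> (x < y)%N}.
Hypothesis rank_bot : rank (\bot : P) = 0%N.
Hypothesis inc_unique : forall x y : P, x <= y ->
  exists2 s, rchain rkP x y s && rincreasing lam <%O x s &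
    forall s', rchain rkP x y s' -> rincreasing lam <%O x s' -> s' = s.

Definition proj (i : 'I_t) (x : Q) : P := tnth (spval x) i.

Definition segre_rank (x : Q) : nat := rank (proj (Ordinal t_gt0) x).

Definition segre_label (x y : Q) : 'I_t -> L :=
  fun i => lam (proj i x) (proj i y).

(** Chosen so that an ascent in the Segre power is a common ascent of the coordinate chains
    ([ascent_proj]). *)
Definition all_lt : rel ('I_t -> L) := fun a b => [forall i, a i < b i].

Lemma proj_bot i : proj i \bot = \bot.
Proof. by rewrite /proj tnth_mktuple. Qed.

Lemma proj_top i : proj i \top = \top.
Proof. by rewrite /proj tnth_mktuple. Qed.

Lemma proj_inj (x y : Q) : (forall i, proj i x = proj i y) -> x = y.
Proof. by move=> h; apply/val_inj/eq_from_tnth. Qed.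

Lemma segre_leE (x y : Q) : (x <= y) = [forall i, proj i x <= proj i y].
Proof. by rewrite leEsub Order.TupleProdOrder.leEtprod. Qed.

Lemma rank_proj i (x : Q) : rank (proj i x) = segre_rank x.
Proof. by apply/eqP; have /'forall_forallP := spvalP x; apply. Qed.

Lemma segre_rank_mono : {homo segre_rank : x y / x < y >-> (x < y)%N}.
Proof.
move=> x y; rewrite lt_neqAle segre_leE => /andP[ne /forallP le].
have [i nei] : exists i, proj i x != proj i y.
  apply/existsP; apply: contraR ne; rewrite negb_exists => /forallP h.
  by apply/eqP/proj_inj => i; apply/eqP; have := h i; rewrite negbK.
by rewrite -!(rank_proj i) rank_mono // lt_neqAle nei le.
Qed.

(** Every coordinate shares the rank of the tuple, so a step of rank one cannot leave a coordinate
    fixed. *)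
Lemma rcovers_proj (x y : Q) :
  rcovers segre_rank x y = [forall i, rcovers rkP (proj i x) (proj i y)].
Proof.
apply/andP/forallP => [[xy /eqP e] i|h].
  rewrite /rcovers !rank_proj e eqxx andbT lt_neqAle.
  have /forallP -> : [forall i, proj i x <= proj i y] by rewrite -segre_leE ltW.
  rewrite andbT; apply/eqP => /(congr1 rkP)/eqP.
  by rewrite !rank_proj e ltn_eqF.
have e : segre_rank y == (segre_rank x).+1.
  by have /andP[_] := h (Ordinal t_gt0); rewrite !rank_proj.
split=> //; rewrite lt_neqAle segre_leE; apply/andP; split.
  by apply/eqP => xy; rewrite xy ltn_eqF in e.
by apply/forallP => i; have /andP[/ltW] := h i.
Qed.

Lemma rchain_proj i (x y : Q) s : rchain segre_rank x y s ->
  rchain rkP (proj i x) (proj i y) (map (proj i) s).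
Proof.
case/andP=> ps /eqP ly; rewrite /rchain last_map ly eqxx andbT path_map.
by apply: sub_path ps => u v; rewrite rcovers_proj => /forallP/(_ i).
Qed.

(** The coordinate chains share their length, the rank difference, and their elements at equal
    height have equal rank, so they combine into elements of the Segre power. *)
Lemma rchain_tuple (x y : Q) (s_ : 'I_t -> seq P) :
    (forall i, rchain rkP (proj i x) (proj i y) (s_ i)) ->
  exists2 u, rchain segre_rank x y u & forall i, map (proj i) u = s_ i.
Proof.
move=> cs.
have [k sz] : exists k, forall i, size (s_ i) = k.
  exists (segre_rank y - segre_rank x)%N => i.
  by rewrite -(rank_proj i y) (rchain_size (cs i)) rank_proj addKn.
elim: k => [|k IH] in x s_ cs sz *.
  have s0 i : s_ i = [::] by apply/size0nil.
  exists [::] => [|i]; last by rewrite s0.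
  apply/eqP/proj_inj => i.
  by have := cs i; rewrite s0 => /andP[_ /eqP].
pose h i := head \bot (s_ i).
have sE i : s_ i = h i :: behead (s_ i) by rewrite /h; case: (s_ i) (sz i).
have ch i : rcovers rkP (proj i x) (h i).
  by have := cs i; rewrite sE => /andP[/= /andP[]].
have er : equal_rank ([tuple h i | i < t] : t.-tupleprod P).
  apply/'forall_forallP => i j; rewrite !tnth_mktuple.
  have /andP[_ /eqP->] := ch i; have /andP[_ /eqP->] := ch j.
  by rewrite !rank_proj.
pose z : Q := SegrePower er.
have pz i : proj i z = h i by rewrite /proj tnth_mktuple.
have [|i|u cu pu] := IH z (fun i => behead (s_ i)).
- by move=> i; have := cs i; rewrite pz {1}sE /rchain /= => /andP[/andP[_ ->]].
- by rewrite size_behead sz.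
exists (z :: u) => [|i]; last by rewrite /= pz pu -sE.
case/andP: cu => pu' lu; rewrite /rchain /= pu' lu !andbT rcovers_proj.
by apply/forallP => i; rewrite pz.
Qed.

Lemma map_proj_inj (u v : seq Q) :
  (forall i, map (proj i) u = map (proj i) v) -> u = v.
Proof.
elim: u v => [|x u IH] [|y v] h //.
- by have := h (Ordinal t_gt0).
- by have := h (Ordinal t_gt0).
congr (_ :: _); first by apply: proj_inj => i; have [] := h i.
by apply: IH => i; have [] := h i.
Qed.

Lemma ascent_proj (x : Q) s k : ascent segre_label all_lt x s k =
  [forall i, ascent lam <%O (proj i x) (map (proj i) s) k].
Proof.
apply: eq_forallb => i; rewrite /ascent -map_cons /segre_label.
have h j : nth \bot (map (proj i) (x :: s)) j = proj i (nth \bot (x :: s) j).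
  case: (ltnP j (size (x :: s))) => lt; first exact: nth_map.
  by rewrite !nth_default ?size_map // proj_bot.
by rewrite !h.
Qed.

Lemma rincreasing_proj (x : Q) s : rincreasing segre_label all_lt x s =
  [forall i, rincreasing lam <%O (proj i x) (map (proj i) s)].
Proof.
apply/rincreasingP/forallP => [h i|h k lt].
  apply/rincreasingP => k; rewrite size_map => /h.
  by rewrite ascent_proj => /forallP/(_ i).
rewrite ascent_proj; apply/forallP => i.
by have /rincreasingP := h i; apply; rewrite size_map.
Qed.

(** Bundle the increasing chains of the coordinate intervals; any increasing chain of tuples
    projects to these, which forces uniqueness. *)
Lemma segre_inc_unique (x y : Q) : x <= y ->
  exists2 s, rchain segre_rank x y s && rincreasing segre_label all_lt x s &
    forall s', rchain segre_rank x y s' ->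
      rincreasing segre_label all_lt x s' -> s' = s.
Proof.
rewrite segre_leE => /forallP le.
have ex i : exists s,
    rchain rkP (proj i x) (proj i y) s && rincreasing lam <%O (proj i x) s.
  by have [s hs _] := inc_unique (le i); exists s.
pose s_ i := xchoose (ex i).
have cs i : rchain rkP (proj i x) (proj i y) (s_ i).
  by case/andP: (xchooseP (ex i)).
have incs i : rincreasing lam <%O (proj i x) (s_ i).
  by case/andP: (xchooseP (ex i)).
have [u cu pu] := rchain_tuple cs.
exists u => [|v cv iv].
  by rewrite cu rincreasing_proj; apply/forallP => i; rewrite pu.
apply: map_proj_inj => i; rewrite pu; have [s _ us] := inc_unique (le i).
rewrite (us _ (cs i) (incs i)); apply: us; first exact: rchain_proj.
by move: iv; rewrite rincreasing_proj => /forallP/(_ i).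
Qed.

Lemma segre_rank_bot : segre_rank \bot = 0%N.
Proof. by rewrite /segre_rank proj_bot. Qed.

Lemma segre_rank_top : segre_rank \top = rank (\top : P).
Proof. by rewrite /segre_rank proj_top. Qed.

Lemma segre_rankE (x : Q) : rank x = segre_rank x.
Proof.
apply: rank_unique => [|{}x]; first exact: segre_rank_mono.
have [s /andP[cs _] _] := segre_inc_unique (le0x x).
exists s; rewrite (rchain_size cs) segre_rank_bot add0n eqxx andbT.
case/andP: cs => ps ->; rewrite andbT.
by apply: sub_path ps => y z /andP[].
Qed.

(** Projecting to coordinates is injective by [map_proj_inj] and onto by [rchain_tuple]. *)
Lemma card_segre_Des_chains n (J : {set 'I_n}) :
  #|Des_chains segre_rank segre_label all_lt J| =
  #|[set c : {ffun 'I_t -> n.-tuple P} |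
      [forall i, rchain rkP \bot \top (c i)] &
      [forall k : 'I_n, (0 < k)%N ==>
         ([forall i, ascent lam <%O \bot (c i) k] != (k \in J))]]|.
Proof.
pose Phi (s : n.-tuple Q) : {ffun 'I_t -> n.-tuple P} :=
  [ffun i => map_tuple (proj i) s].
rewrite -(@card_imset _ _ Phi) => [|s s' /ffunP e]; last first.
  by apply/val_inj/map_proj_inj => i; have /(congr1 val) := e i; rewrite !ffunE.
have asc (s : n.-tuple Q) k : ascent segre_label all_lt \bot s k =
    [forall i, ascent lam <%O \bot (Phi s i) k].
  by rewrite ascent_proj; apply: eq_forallb => i; rewrite ffunE proj_bot.
apply: eq_card => c; apply/imsetP/idP => [[s + ->]|].
  rewrite !inE => /andP[cs /forallP h]; apply/andP; split.
    apply/forallP => i.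
    by rewrite ffunE -(proj_bot i) -(proj_top i) rchain_proj.
  by apply/forallP => k; rewrite -asc.
rewrite inE => /andP[/forallP cc /forallP h].
have [|u cu pu] := @rchain_tuple \bot \top (fun i => c i).
  by move=> i; rewrite proj_bot proj_top.
have sz : size u == n.
  by rewrite -(size_map (proj (Ordinal t_gt0))) pu size_tuple.
have PhiE : c = Phi (Tuple sz).
  by apply/ffunP => i; apply/val_inj; rewrite ffunE /= pu.
exists (Tuple sz) => //; rewrite inE cu; apply/forallP => k.
by rewrite asc -PhiE.
Qed.

End SegreChains.

(** * Sums over label words *)

Local Open Scope classical_set_scope.
Local Open Scope ring_scope.

(** The index type may be infinite, but only values of [g] give nonzero terms, so the sum reduces to
    the finite image of [g]. *)
Lemma fsbig_card_fibers (T : finType) (X : choiceType) (g : T -> X)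
    (D : pred T) (a : pred X) (A : set X) : (forall x, A x <-> a x) ->
  \sum_(x \in A) #|[set c | D c & g c == x]%SET|%:Z =
  #|[set c | D c & a (g c)]%SET|%:Z.
Proof.
move=> Aa; have -> : A = [set` a] by apply/seteqP; split=> x /Aa.
rewrite -(@bigfs _ _ _ _ (undup [seq g c | c : T])) ?undup_uniq //; last first.
  move=> x _ xr; apply/eqP; rewrite eqz_nat; apply/eqP/eq_card0 => c.
  rewrite !inE; apply/andP => -[_ /eqP e]; move: xr.
  by rewrite mem_undup -e map_f // mem_enum.
transitivity (\sum_(x <- undup [seq g c | c : T] | a x)
    \sum_(c : T | D c && (g c == x)) 1 : int).
  by apply: eq_bigr => x _; rewrite -natz -sum1dep_card natr_sum.
rewrite (exchange_big_dep (fun c => D c && a (g c))) /=; last first.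
  by move=> x c ax /andP[-> /eqP->].
rewrite -natz -sum1dep_card natr_sum; apply: eq_bigr => c /andP[Dc ac].
rewrite (eq_bigl (fun x => x == g c)) => [|x].
  rewrite big_mkcond (bigD1_seq (g c)) ?undup_uniq //=.
    by rewrite eqxx big1 ?addr0 // => x /negbTE ->.
  by rewrite mem_undup map_f // mem_enum.
by rewrite Dc /= eq_sym; case: eqP => [->|]; rewrite ?ac ?andbF.
Qed.

Section LabelWords.
Context {d d' : Order.disp_t} {P : finTBPOrderType d} {L : porderType d'}.
Variables (lam : P -> P -> L) (n : nat).

Definition label_tuple (c : n.-tuple P) : n.-tuple L :=
  pairmap_tuple lam \bot%O c.

Lemma elE sigma : el lam sigma =
  #|[set c : n.-tuple P |
      maximal_chain \bot%O \top%O c & label_tuple c == sigma]%SET|.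
Proof. by []. Qed.

Lemma in_Asc_label (c : n.-tuple P) (i : 'I_n) : (0 < i)%N ->
  (i \in Asc (label_tuple c)) = ascent lam <%O%O \bot%O c i.
Proof.
move=> i0; rewrite !inE i0 /= !(tnth_nth (lam \bot%O \bot%O)) /=.
(* [ord_pred] is cyclic on ['I_n]; a positive [i] does not wrap around. *)
have ip : ((i + n).-1 %% n)%N = i.-1.
  have -> : ((i + n).-1 = i.-1 + n)%N by case: (i : nat) i0.
  by rewrite modnDr modn_small // (leq_ltn_trans (leq_pred i)).
have lt : (i.-1 < n)%N by apply: leq_ltn_trans (leq_pred i) (ltn_ord i).
rewrite ip !(nth_pairmap \bot%O) ?size_tuple //.
by rewrite /ascent; case: (i : nat) i0.
Qed.

(** Position 0 lies outside both sets, so only positive positions have to be compared. *)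
Lemma interior_setD_eq (A J : {set 'I_n}) : J \subset interior n ->
  (interior n :\: A == J)%SET =
  [forall i : 'I_n, (0 < i)%N ==> ((i \in A) != (i \in J))].
Proof.
move=> /fintype.subsetP Jint; apply/eqP/forallP => [<- i|h].
  by apply/implyP => i0; rewrite !inE i0; case: (i \in A).
apply/setP => i; rewrite !inE; have := h i; have := Jint i; rewrite inE.
by case: (0 < i)%N; case: (i \in A); case: (i \in J) => // /(_ isT).
Qed.

Lemma Des_label (c : n.-tuple P) (J : {set 'I_n}) : J \subset interior n ->
  (Des (label_tuple c) == J) =
  [forall i : 'I_n, (0 < i)%N ==> (ascent lam <%O%O \bot%O c i != (i \in J))].
Proof.
move=> Jint; rewrite interior_setD_eq //; apply: eq_forallb => i.
by case: ltnP => //= i0; rewrite in_Asc_label.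
Qed.

Lemma sum_el (J : {set 'I_n}) : J \subset interior n ->
    (forall c : n.-tuple P, maximal_chain \bot%O \top%O c =
                            rchain (@rank d P) \bot%O \top%O c) ->
  \sum_(sigma \in [set w : n.-tuple L | Des w = J]) (el lam sigma)%:Z =
  #|Des_chains (@rank d P) lam <%O%O J|%:Z.
Proof.
move=> Jint mcE.
under eq_fsbigr do rewrite elE.
rewrite (@fsbig_card_fibers _ _ _ _ (fun w => Des w == J)); last first.
  by move=> w; split=> /eqP.
congr (Posz _); apply: eq_card => c; rewrite !inE mcE; congr (_ && _).
exact: Des_label.
Qed.

(** Chains for the separate words are chosen independently; distributivity turns the product of
    counts into a count of families. *)
Lemma prod_el t (s : t.-tuple (n.-tuple L)) :
  \prod_(i < t) (el lam (tnth s i))%:Z =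
  #|[set c : {ffun 'I_t -> n.-tuple P} |
      [forall i, maximal_chain \bot%O \top%O (c i)] &
      [tuple label_tuple (c i) | i < t] == s]%SET|%:Z.
Proof.
rewrite -natz -sum1dep_card.
transitivity ((\prod_(i < t) \sum_(c : n.-tuple P |
    maximal_chain \bot%O \top%O c &&
    (label_tuple c == tnth s i)) 1)%N%:R : int).
  by rewrite natr_prod; apply: eq_bigr => i _; rewrite natz elE -sum1dep_card.
congr (_%:R); rewrite bigA_distr_big_dep /=.
apply: eq_big => [c|c _]; last by rewrite big1.
apply/familyP/andP => [h|[/forallP mc /eqP <-] i]; last first.
  by rewrite unfold_in mc tnth_mktuple eqxx.
split; first by apply/forallP => i; have := h i; rewrite unfold_in => /andP[].
apply/eqP/eq_from_tnth => i; rewrite tnth_mktuple.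
by have := h i; rewrite unfold_in => /andP[_ /eqP].
Qed.

Lemma sum_prod_el t (J : {set 'I_n}) : J \subset interior n ->
    (forall c : n.-tuple P, maximal_chain \bot%O \top%O c =
                            rchain (@rank d P) \bot%O \top%O c) ->
  \sum_(s \in [set s : t.-tuple (n.-tuple L) | tuple_Des s = J])
     \prod_(i < t) (el lam (tnth s i))%:Z =
  #|[set c : {ffun 'I_t -> n.-tuple P} |
      [forall i, rchain (@rank d P) \bot%O \top%O (c i)] &
      [forall k : 'I_n, (0 < k)%N ==>
         ([forall i, ascent lam <%O%O \bot%O (c i) k] != (k \in J))]]%SET|%:Z.
Proof.
move=> Jint mcE.
under eq_fsbigr do rewrite prod_el.
rewrite (@fsbig_card_fibers _ _ _ _ (fun s => tuple_Des s == J)); last first.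
  by move=> w; split=> /eqP.
congr (Posz _); apply: eq_card => c; rewrite !inE; congr (_ && _).
  by apply: eq_forallb => i; rewrite mcE.
rewrite /tuple_Des interior_setD_eq //; apply: eq_forallb => k.
case: ltnP => //= k0; congr (_ != _).
apply/bigcapP/forallP => [h i|h i _].
  by have := h i isT; rewrite tnth_mktuple in_Asc_label.
by rewrite tnth_mktuple in_Asc_label.
Qed.

End LabelWords.

(** An intersection over at least one word stays inside [interior n]; removing it leaves the whole
    interior only if it is empty. *)
Lemma tuple_Des_interior (d' : Order.disp_t) (L : porderType d') (n t : nat)
    (s : t.-tuple (n.-tuple L)) : (0 < t)%N ->
  tuple_Des s = interior n <-> common_Asc s = finset.set0.
Proof.
move=> t_gt0; rewrite /tuple_Des; split=> [e|->]; last by rewrite finset.setD0.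
apply/setP => i; rewrite inE; apply/negP => iA.
have : i \in interior n.
  have /bigcapP/(_ (Ordinal t_gt0) isT) := iA.
  by rewrite inE => /andP[].
by rewrite -e inE iA.
Qed.

Theorem theorem2p7 (d d' : Order.disp_t) (P : finTBPOrderType d)
  (L : porderType d') (n t : nat) (lam : P -> P -> L)
  (n_gt0 : (0 < n)%N) (t_gt0 : (0 < t)%N)
  (gradedP : graded P n) (EL : EL_labeling lam) :
  ((forall J : {set 'I_n}, J \subset interior n ->
      (-1) ^ (#|J|%:Z - 1) * mobius_number (rank_selection P J) =
      \sum_(sigma \in [set w : n.-tuple L | Des w = J]) (el lam sigma)%:Z)
   /\
   (-1) ^ (n%:Z - 2) * mobius_number P =
   \sum_(sigma \in [set w : n.-tuple L | Des w = interior n])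
      (el lam sigma)%:Z)
  /\
  ((forall J : {set 'I_n}, J \subset interior n ->
      (-1) ^ (#|J|%:Z - 1) *
        mobius_number (rank_selection (segre_power P t) J) =
      \sum_(s \in [set s : t.-tuple (n.-tuple L) | tuple_Des s = J])
        \prod_(i < t) (el lam (tnth s i))%:Z)
   /\
   (-1) ^ (n%:Z - 2) * mobius_number (segre_power P t) =
   \sum_(s \in [set s : t.-tuple (n.-tuple L) | common_Asc s = finset.set0])
     \prod_(i < t) (el lam (tnth s i))%:Z).
Proof.
have mono := EL_rank_mono gradedP EL.
have bot0 := EL_rank_bot gradedP EL.
have topn := EL_rank_top gradedP EL.
have incu := EL_inc_unique gradedP EL.
have mcE (c : n.-tuple P) := maximal_chainE gradedP EL \bot%O \top%O c.
(* The Segre power inherits the same properties, so one Möbius formula serves both posets. *)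
have smono := segre_rank_mono t_gt0 mono.
have sbot0 := segre_rank_bot t_gt0 bot0.
have stopn := etrans (segre_rank_top t_gt0) topn.
have srankE := segre_rankE t_gt0 mono bot0 incu.
have sincu := segre_inc_unique t_gt0 incu.
split; split.
- move=> J Jint; rewrite sum_el //.
  exact: (mobius_rank_selection mono bot0 topn (fun=> erefl) incu).
- rewrite sum_el //; exact: (mobius_graded mono bot0 topn (fun=> erefl) incu).
- move=> J Jint; rewrite sum_prod_el // -(card_segre_Des_chains lam t_gt0).
  exact: (mobius_rank_selection smono sbot0 stopn srankE sincu).
rewrite (mobius_graded smono sbot0 stopn srankE sincu) //.
rewrite card_segre_Des_chains -sum_prod_el //; apply: eq_fsbigl.
by apply/seteqP; split=> s /(tuple_Des_interior _ t_gt0).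
Qed.
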